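(* Let $N\geq 3$ be an odd integer and let $\alpha>0$. If $\mathcal{I}_{\alpha,N}(u)\ge 0$ for all $u\in \mathcal{L}_{r,N}$, then $\alpha\ge \frac12$.
   Context: Let $\xi=(\xi_1,\dots,\xi_{N+1})$ denote points of $\mathbb{S}^N\subset\mathbb{R}^{N+1}$ and write $x=\xi_1\in[-1,1]$. A function of the form $u=u(x)$ on $\mathbb{S}^N$ is called axially symmetric. For $N$ odd, the Paneitz operator on $\mathbb{S}^N$ is $$P_N=\Big(-\Delta+\big(\tfrac{N-1}{2}\big)^2\Big)^{1/2}\prod_{k=0}^{\frac{N-3}{2}}(-\Delta+k(N-k-1)),$$ where $\Delta$ is the Laplace–Beltrami operator of the round sphere and the square root is the spectral one. $P_{r,N}$ denotes $P_N$ acting on axially symmetric functions $u=u(x)$ (on such functions, $-\Delta=-(1-x^2)\frac{d^2}{dx^2}+Nx\frac{d}{dx}$). Spectrally, $P_N$ multiplies spherical harmonics of degree $k\ge 1$ by $\Gamma(k+N)/\Gamma(k)$ and kills constants; for $u\in H^{N/2}$ the integral of $uP_{r,N}u$ is understood as the associated quadratic form. For $\alpha>0$ and axially symmetric $u\in H^{N/2}(\mathbb{S}^N)$ define $$\mathcal{I}_{\alpha,N}(u)=\frac{\alpha}{2}\int_{-1}^{1}(1-x^2)^{\frac{N-2}{2}}u\,P_{r,N}u\,dx+(N-1)!\int_{-1}^{1}(1-x^2)^{\frac{N-2}{2}}u\,dx-\frac{(N-1)!\sqrt{\pi}\,\Gamma(\frac N2)}{N\,\Gamma(\frac{N+1}{2})}\log\left(\frac{\Gamma(\frac{N+1}{2})}{\sqrt{\pi}\,\Gamma(\frac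 N2)}\int_{-1}^{1}(1-x^2)^{\frac{N-2}{2}}e^{Nu}\,dx\right),$$ and $$\mathcal{L}_{r,N}=\Big\{u\in H^{\frac N2}(\mathbb{S}^N):\ u=u(x)\ \text{and}\ \int_{-1}^{1}x(1-x^2)^{\frac{N-2}{2}}e^{Nu}\,dx=0\Big\}.$$ *)

(* Defs.v *)
From mathcomp Require Import all_boot all_order all_algebra zify ring.
From mathcomp Require Import all_classical all_reals all_analysis.
Import Order.TTheory GRing.Theory Num.Theory.
Import numFieldNormedType.Exports.

Set Implicit Arguments.
Unset Strict Implicit.
Unset Printing Implicit Defensive.

Local Open Scope classical_set_scope.
Local Open Scope ring_scope.

(* An axially symmetric function on S^N is represented by its profile
   u : R -> R, of which only the restriction to [-1, 1] matters. *)

Definition Gamma {R : realType} (s : R) : R :=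
  \int[lebesgue_measure]_(t in `]0, +oo[) (t `^ (s - 1) * expR (- t)).

(* The integral of (1 - x^2)^((N-2)/2) f(x) over [-1, 1].  It is the integral
   over S^N of the function f(xi_1), up to the factor |S^(N-1)|. *)
Definition axial_weight {R : realType} (N : nat) (x : R) : R :=
  (1 - x ^+ 2) `^ ((N%:R - 2) / 2).

Definition axial_int {R : realType} (N : nat) (f : R -> R) : R :=
  \int[lebesgue_measure]_(x in `[-1, 1]) (axial_weight N x * f x).

Definition axial_L2 {R : realType} (N : nat) (u : R -> R) : Prop :=
  measurable_fun `[(-1 : R), 1] u /\
  lebesgue_measure.-integrable `[(-1 : R), 1]
    (fun x => (axial_weight N x * u x ^+ 2)%:E).

(* -Delta (with this sign) applied to the function p(xi_1). *)
Definition axial_laplacian {R : realType} (N : nat) (p : {poly R}) : {poly R} :=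
  - ((1 - 'X^2) * p^`()^`()) + N%:R *: ('X * p^`()).

Definition laplace_eigenvalue {R : realType} (N k : nat) : R :=
  k%:R * (k%:R + N%:R - 1).

(* Gegenbauer polynomials, by
   n C_n = 2 (n + l - 1) x C_(n-1) - (n + 2 l - 2) C_(n-2). *)
Fixpoint gegenbauer {R : realType} (l : R) (n : nat) : {poly R} :=
  match n with
  | 0 => 1
  | n1.+1 => match n1 with
    | 0 => (2 * l) *: 'X
    | n2.+1 => n%:R^-1 *: ((2 * (n1%:R + l)) *: ('X * gegenbauer l n1)
                          - (n2%:R + 2 * l) *: gegenbauer l n2)
    end
  end.

(* The axially symmetric spherical harmonics of degree k are the multiples of
   zonal N k; see size_zonal and axial_laplacian_zonal. *)
Definition zonal {R : realType} (N k : nat) : {poly R} :=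
  gegenbauer ((N%:R - 1) / 2) k.

(* Orthogonal projection onto the spherical harmonics of degree k. *)
Definition harmonic_proj {R : realType} (N k : nat) (u : R -> R) (x : R) : R :=
  axial_int N (fun y => u y * (zonal N k).[y])
  / axial_int N (fun y => (zonal N k).[y] ^+ 2) * (zonal N k).[x].

(* The quadratic form of F(-Delta), i.e. the squared norm of F(-Delta)^(1/2) u
   in the weighted L2 norm, for F >= 0 on the spectrum. *)
Definition spectral_form {R : realType} (N : nat) (F : R -> R) (u : R -> R)
    : \bar R :=
  (\sum_(0 <= k <oo) (F (laplace_eigenvalue N k)
     * axial_int N (fun x => harmonic_proj N k u x ^+ 2))%:E)%E.

(* u(xi_1) belongs to H^s(S^N), i.e. u and (1 - Delta)^(s/2) u are in L2. *)
Definition axial_sobolev {R : realType} (N : nat) (s : R) (u : R -> R) : Prop :=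
  axial_L2 N u /\ (spectral_form N (fun l => (1 + l) `^ s)%R u < +oo)%E.

(* P_N = paneitz_symbol N (-Delta), for N odd. *)
Definition paneitz_symbol {R : realType} (N : nat) (l : R) : R :=
  Num.sqrt (l + ((N%:R - 1) / 2) ^+ 2)
  * \prod_(0 <= k < ((N - 3)./2).+1) (l + k%:R * (N%:R - k%:R - 1)).

(* The integral of (1 - x^2)^((N-2)/2) u P_N u, as a quadratic form; the series
   is finite when u is in H^(N/2). *)
Definition paneitz_form {R : realType} (N : nat) (u : R -> R) : R :=
  fine (spectral_form N (paneitz_symbol N) u).

Definition I_functional {R : realType} (alpha : R) (N : nat) (u : R -> R) : R :=
  alpha / 2 * paneitz_form N u
  + (N.-1)`!%:R * axial_int N u
  - (N.-1)`!%:R * Num.sqrt pi * Gamma (N%:R / 2)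
      / (N%:R * Gamma ((N%:R + 1) / 2))
    * ln (Gamma ((N%:R + 1) / 2) / (Num.sqrt pi * Gamma (N%:R / 2))
          * axial_int N (fun x => expR (N%:R * u x))).

Definition L_class {R : realType} (N : nat) : set (R -> R) :=
  [set u | axial_sobolev N (N%:R / 2) u /\
           axial_int N (fun x => x * expR (N%:R * u x)) = 0].

Lemma gegenbauerSS {R : realType} (l : R) (n : nat) :
  n.+2%:R * gegenbauer l n.+2 =
    2 * (n.+1%:R + l%:P) * ('X * gegenbauer l n.+1)
    - (n%:R + 2 * l%:P) * gegenbauer l n.
Proof.
have -> : gegenbauer l n.+2 =
    n.+2%:R^-1 *: ((2 * (n.+1%:R + l)) *: ('X * gegenbauer l n.+1)
      - (n%:R + 2 * l) *: gegenbauer l n) by [].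
rewrite -[n.+2%:R in LHS]polyC_natr mul_polyC scalerA divff ?scale1r ?pnatr_eq0//.
by rewrite -!mul_polyC !(polyCD, polyCM) !polyC_natr.
Qed.

Lemma size_gegenbauer {R : realType} (l : R) (n : nat) :
  0 < l -> size (gegenbauer l n) = n.+1.
Proof.
move=> l0; elim/ltn_ind: n => -[|[|n]] IH; first by rewrite size_poly1.
  by rewrite /= size_scale ?size_polyX// mulf_neq0// ?gt_eqF// ltr0n.
have G1 : size (gegenbauer l n.+1) = n.+2 by apply: IH.
have c0 : 2 * (n.+1%:R + l) != 0 by rewrite gt_eqF// mulr_gt0// addr_gt0// ltr0n.
have S1 : size ((2 * (n.+1%:R + l)) *: ('X * gegenbauer l n.+1)) = n.+3.
  by rewrite size_scale// mulrC size_mulX ?G1// -size_poly_eq0 G1.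
rewrite [gegenbauer l n.+2]/= size_scale ?invr_eq0 ?pnatr_eq0//.
rewrite size_polyDl S1// size_polyN.
by apply: leq_ltn_trans (size_scale_leq _ _) _; rewrite IH.
Qed.

Lemma deriv_gegenbauer {R : realType} (l : R) (n : nat) :
  (1 - 'X^2) * (gegenbauer l n)^`() =
    (n%:R + 2 * l%:P) * 'X * gegenbauer l n - n.+1%:R * gegenbauer l n.+1 /\
  (1 - 'X^2) * (gegenbauer l n.+1)^`() =
    (n%:R + 2 * l%:P) * gegenbauer l n - n.+1%:R * 'X * gegenbauer l n.+1.
Proof.
elim: n => [|n [IHB IHA]].
  by rewrite /= -mul_polyC polyCM poly.derivE derivM derivX; split; rewrite ?poly.derivE; ring.
have rec := gegenbauerSS l n.
have drec : n.+2%:R * (gegenbauer l n.+2)^`() =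
    2 * (n.+1%:R + l%:P) * (gegenbauer l n.+1 + 'X * (gegenbauer l n.+1)^`())
    - (n%:R + 2 * l%:P) * (gegenbauer l n)^`().
  have := congr1 (@deriv R) rec.
  move: (gegenbauer l n.+2) (gegenbauer l n.+1) (gegenbauer l n) => C2 C1 C0.
  rewrite !poly.derivE => E; apply: etrans (etrans _ E) _; ring.
have n2 : n.+2%:R != 0 :> {poly R} by rewrite -polyC_natr polyC_eq0 pnatr_eq0.
move: (gegenbauer l n.+2) (gegenbauer l n.+1) (gegenbauer l n)
  IHA IHB rec drec n2 => C2 C1 C0 IHA IHB rec drec n2.
split; first by rewrite IHA rec; ring.
apply: (mulfI n2).
have -> : n.+2%:R * ((1 - 'X^2) * C2^`()) = (1 - 'X^2) * (n.+2%:R * C2^`()).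
  by ring.
have -> : n.+2%:R * ((n.+1%:R + 2 * l%:P) * C1 - n.+2%:R * 'X * C2) =
  n.+2%:R * (n.+1%:R + 2 * l%:P) * C1 - n.+2%:R * 'X * (n.+2%:R * C2) by ring.
rewrite drec rec.
transitivity (2 * (n.+1%:R + l%:P) * ((1 - 'X^2) * C1
    + 'X * ((1 - 'X^2) * C1^`())) - (n%:R + 2 * l%:P) * ((1 - 'X^2) * C0^`())).
  by ring.
by rewrite IHA IHB; ring.
Qed.

Lemma size_zonal {R : realType} (N k : nat) :
  (1 < N)%N -> size (zonal N k : {poly R}) = k.+1.
Proof.
by move=> N1; apply: size_gegenbauer; rewrite divr_gt0// subr_gt0 ltr1n.
Qed.

Lemma axial_laplacian_zonal {R : realType} (N k : nat) :
  axial_laplacian N (zonal N k : {poly R}) =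
  laplace_eigenvalue N k *: zonal N k.
Proof.
rewrite /axial_laplacian /zonal /laplace_eigenvalue.
set l : R := (N%:R - 1) / 2.
have : N%:R = 2 * l + 1 :> R by rewrite /l; field.
move: l => l Nl.
have X0 : 1 - 'X^2 != 0 :> {poly R}.
  by rewrite -oppr_eq0 opprB -size_poly_eq0 size_XnsubC.
case: k => [|k]; first by rewrite mul0r scale0r /= derivC derivC !mulr0 oppr0 scaler0 addr0.
have [IHB IHA] := deriv_gegenbauer l k.
have dA := congr1 (@deriv R) IHA.
move: (gegenbauer l k.+1) (gegenbauer l k) IHA IHB dA => C1 C0 IHA IHB.
rewrite !poly.derivE => dA.
have {}dA : (1 - 'X^2) * C1^`()^`() = (k%:R + 2 * l%:P) * C0^`()
    - k.+1%:R * (C1 + 'X * C1^`()) + 2 * 'X * C1^`().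
  have -> : (1 - 'X^2) * C1^`()^`() =
    (0 - 'X *+ 2) * C1^`() + (1 - 'X^2) * C1^`()^`() + 2 * 'X * C1^`() by ring.
  by rewrite {}dA; ring.
have kC0 : (k%:R + 2 * l%:P) * C0 = (1 - 'X^2) * C1^`() + k.+1%:R * 'X * C1.
  by rewrite IHA; ring.
have -> : k.+1%:R * (k.+1%:R + N%:R - 1) = k.+1%:R * (k.+1%:R + 2 * l) :> R.
  by rewrite Nl; ring.
rewrite Nl -!mul_polyC !(polyCD, polyCM) !polyC_natr dA.
apply: (mulfI X0).
transitivity (- ((k%:R + 2 * l%:P) * ((1 - 'X^2) * C0^`())
    - k.+1%:R * ((1 - 'X^2) * C1 + 'X * ((1 - 'X^2) * C1^`()))
    + 2 * 'X * ((1 - 'X^2) * C1^`()))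
    + (2 * l%:P + 1) * 'X * ((1 - 'X^2) * C1^`())); first by ring.
rewrite IHB.
transitivity (- ('X * (k%:R + 2 * l%:P) * ((k%:R + 2 * l%:P) * C0)
    - (k%:R + 2 * l%:P) * k.+1%:R * C1
    - k.+1%:R * ((1 - 'X^2) * C1 + 'X * ((1 - 'X^2) * C1^`()))
    + 2 * 'X * ((1 - 'X^2) * C1^`()))
    + (2 * l%:P + 1) * 'X * ((1 - 'X^2) * C1^`())); first by ring.
by rewrite kC0; ring.
Qed.

(* The eigenvalue Gamma(k + N) / Gamma(k) of P_N, and 0 for k = 0. *)
Lemma paneitz_symbol_eigenvalue {R : realType} (N k : nat) :
  (3 <= N)%N -> odd N ->
  paneitz_symbol N (laplace_eigenvalue N k) =
  \prod_(0 <= j < N) (k%:R + j%:R) :> R.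
Proof.
move=> N3 oN; have [m Nm] : exists m, N = m.+1.*2.+1.
  exists (N./2.-1); rewrite prednK ?half_gt0 ?(leq_trans _ N3)//.
  by rewrite -[LHS]odd_double_half oN.
rewrite /paneitz_symbol /laplace_eigenvalue {N3 oN}Nm.
have -> : (m.+1.*2.+1 - 3)./2 = m by rewrite doubleS !subSS subn0 doubleK.
have NE : (m.+1.*2.+1)%:R = 2 * m.+1%:R + 1 :> R.
  by rewrite -natr1 -mul2n natrM.
have -> : k%:R * (k%:R + (m.+1.*2.+1)%:R - 1) + (((m.+1.*2.+1)%:R - 1) / 2) ^+ 2
    = (k%:R + m.+1%:R) ^+ 2 :> R by rewrite NE; field.
rewrite sqrtr_sqr ger0_norm ?addr_ge0//.
rewrite (@big_cat_nat _ _ _ m.+1 0 m.+1.*2.+1)// /=; last by lia.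
rewrite [\prod_(m.+1 <= i < _) _]big_ltn; last by lia.
have -> : \prod_(m.+2 <= j < m.+1.*2.+1) (k%:R + j%:R) =
    \prod_(0 <= j < m.+1) (k%:R + (m.+1.*2 - j)%:R) :> R.
  rewrite -[m.+2]add0n big_addn.
  have -> : (m.+1.*2.+1 - m.+2 = m.+1)%N by lia.
  rewrite big_nat_rev; apply: eq_big_nat => j /andP[_ jm]; congr (_ + _%:R).
  by lia.
rewrite mulrCA; congr (_ * _); rewrite -big_split/=.
apply: eq_big_nat => j /andP[_ jm].
rewrite natrB; last by lia.
by rewrite NE -mul2n natrM; ring.
Qed.

(* Main.v *)
Require Import Defs.
From HB Require Import structures.
From mathcomp Require Import all_boot all_order all_algebra ring lra zify.
From mathcomp Require Import all_classical all_reals all_analysis.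
From mathcomp Require Import measurable_realfun.
Import Order.TTheory GRing.Theory Num.Theory.
Import numFieldNormedType.Exports.
Set Implicit Arguments.
Unset Strict Implicit.
Unset Printing Implicit Defensive.
Local Open Scope classical_set_scope.
Local Open Scope ring_scope.

(* Write N = 2l + 1, A = int (1-x^2)^((N-2)/2) dx, and let C_k be the Gegenbauer
   polynomial of parameter l and degree k.  The test functions are the even
   polynomials
     u = sum_(0 < k <= 2K, k even) 4 b_k C_k / C_k(1),
     b_k = (k + l) / (k (k + 2l)),
   truncations (up to a constant) of the sum of the Green functions of P_N at
   the two poles.  Being even, u satisfies the balance condition, and its mean
   is 0.  With S = sum b_k, which is (log K) / 2 + O(1), the quadratic form of
   P_N at u is 8 (N-1)! A S by orthogonality, while u >= 4 S - O(1) on a cap of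
   height of order K^(-2), whose weighted measure is of order K^(-N).  So the
   logarithm in I_alpha is at least N (4 S - log K) - O(1) = 2 N S - O(1), and
     I_alpha(u) <= (N-1)! A ((4 alpha - 2) S + O(1)).
   As S tends to infinity with K, nonnegativity forces alpha >= 1/2. *)

(** * Gegenbauer polynomials near the pole *)

Lemma gegenbauerSS_horner {R : realType} (l : R) (n : nat) (x : R) :
  n.+2%:R * (gegenbauer l n.+2).[x] =
    2 * (n.+1%:R + l) * (x * (gegenbauer l n.+1).[x])
    - (n%:R + 2 * l) * (gegenbauer l n).[x].
Proof.
have := congr1 (horner^~ x) (gegenbauerSS l n).
by rewrite !(hornerE, hornerMn) mulr_natl.
Qed.

(** At [1] the factor 1 - x^2 removes the derivative from the first identity of
    [deriv_gegenbauer]. *)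
Lemma gegenbauer1S {R : realType} (l : R) (n : nat) :
  n.+1%:R * (gegenbauer l n.+1).[1] = (n%:R + 2 * l) * (gegenbauer l n).[1].
Proof.
have := congr1 (horner^~ 1) (deriv_gegenbauer l n).1.
rewrite !(hornerE, hornerMn) => E.
by apply/eqP; rewrite eq_sym -subr_eq0; apply/eqP; rewrite -E; ring.
Qed.

Lemma gegenbauer1_gt0 {R : realType} (l : R) (n : nat) :
  0 < l -> 0 < (gegenbauer l n).[1].
Proof.
move=> l0; elim: n => [|n IH]; first by rewrite hornerE.
have n0 : 0 < n.+1%:R :> R by rewrite ltr0n.
rewrite -(pmulr_rgt0 _ n0) gegenbauer1S mulr_gt0//.
by rewrite ltr_wpDl// mulr_gt0.
Qed.

Lemma gegenbauerN {R : realType} (l : R) (n : nat) (x : R) :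
  (gegenbauer l n).[- x] = (-1) ^+ n * (gegenbauer l n).[x].
Proof.
elim/ltn_ind: n => -[|[|n]] IH; first by rewrite !hornerE.
  by rewrite expr1 [gegenbauer _ _]/= !hornerZ !hornerX; ring.
have n0 : n.+2%:R != 0 :> R by rewrite pnatr_eq0.
apply: (mulfI n0); rewrite mulrCA !gegenbauerSS_horner !IH//.
by rewrite !exprS; ring.
Qed.

(* With [d_n = C_n / C_n(1)] and [t = 1 - x], the three-term recurrence reads
   [(n + 2 l) (d_n - d_(n+1)) = n (d_(n-1) - d_n) + 2 (n + l) t d_n], so that
   the differences stay nonnegative as long as [d_n] does. *)
Lemma gegenbauer_near1 {R : realType} (l x : R) (n : nat) :
  0 < l -> x <= 1 -> n%:R * n.+1%:R * (1 - x) <= 1 ->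
  (gegenbauer l n).[1] * (1 - n%:R * n.+1%:R * (1 - x)) <= (gegenbauer l n).[x].
Proof.
move=> l0 x1; pose d k := (gegenbauer l k).[x] / (gegenbauer l k).[1].
have c0 k : 0 < (gegenbauer l k).[1] by exact: gegenbauer1_gt0.
have dE k : (gegenbauer l k).[x] = d k * (gegenbauer l k).[1].
  by rewrite /d divfK// gt_eqF.
set t := 1 - x; have t0 : 0 <= t by rewrite subr_ge0.
have rec k : (k.+1%:R + 2 * l) * (d k.+1 - d k.+2) =
    k.+1%:R * (d k - d k.+1) + 2 * (k.+1%:R + l) * t * d k.+1.
  have := gegenbauerSS_horner l k x; rewrite !dE.
  rewrite mulrCA gegenbauer1S [(_ + _) * (d k * _)]mulrCA -(gegenbauer1S l k) => E.
  apply: (mulfI (lt0r_neq0 (c0 k.+1))).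
  rewrite mulrBr mulrBr [X in _ - X](_ : _ =
    d k.+2 * ((k.+1%:R + 2 * l) * (gegenbauer l k.+1).[1])); last by ring.
  by rewrite E /t; ring.
(* The bounds are proved together: the increments 2 (n + 1) t add up to n (n + 1) t, and an upper
   bound on [d] controls the last term of [rec]. *)
suff : n%:R * n.+1%:R * t <= 1 -> [/\ d n <= 1, 0 <= d n - d n.+1 <=
   2 * n.+1%:R * t & 1 - d n <= n%:R * n.+1%:R * t].
  move=> H /H[_ _ {}H]; rewrite dE mulrC ler_pM2r//.
  by rewrite lerBlDr addrC -lerBlDr.
elim: n => [_|n IH].
  have -> : d 0 = 1 by rewrite /d /= !hornerC divr1.
  have -> : d 1 = x.
    by rewrite /d /= !hornerZ !hornerX mulr1 mulrAC divff ?mul1r ?gt_eqF ?mulr_gt0.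
  by split=> //; rewrite /t; lra.
clearbody d; move=> H.
have n0 : 0 <= n%:R :> R by [].
have [|d1 /andP[e0 e1] h] := IH.
  apply: le_trans H; rewrite mulrC [leRHS]mulrC; apply: ler_wpM2l => //.
  by rewrite -!natr1; nra.
have d1S : d n.+1 <= 1 by lra.
have hS : 1 - d n.+1 <= n.+1%:R * n.+2%:R * t.
  by move: h e1; rewrite -!natr1; nra.
(* Here the smallness hypothesis enters: 1 - d_(n+1) is at most (n + 1)(n + 2) t <= 1, so the
   right-hand side of [rec] is nonnegative. *)
have dS0 : 0 <= d n.+1 by lra.
split => //; have := rec n => {rec}.
set e := d n.+1 - d n.+2; set e' := d n - d n.+1 in e0 e1 *.
have nl' : 0 <= n.+1%:R + l by rewrite addr_ge0// ltW.
have nl : 0 < n.+1%:R + 2 * l by rewrite addr_gt0// mulr_gt0.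
move=> rec; rewrite -(pmulr_rge0 _ nl) rec; apply/andP; split.
  by rewrite addr_ge0 ?mulr_ge0.
rewrite -(ler_pM2l nl) rec.
have h1 : n.+1%:R * e' <= n.+1%:R * (2 * n.+1%:R * t) by rewrite ler_wpM2l.
have h2 : 2 * (n.+1%:R + l) * t * d n.+1 <= 2 * (n.+1%:R + l) * t.
  by rewrite ler_piMr ?mulr_ge0.
apply: (le_trans (lerD h1 h2)).
rewrite -subr_ge0.
(* The terms free of [l] cancel; what remains is a positive multiple of l t. *)
have -> : (n.+1%:R + 2 * l) * (2 * n.+2%:R * t) -
  (n.+1%:R * (2 * n.+1%:R * t) + 2 * (n.+1%:R + l) * t) =
  (l * (4 * n.+2%:R - 2)) * t by rewrite -!natr1; ring.
rewrite mulr_ge0// mulr_ge0// ?ltW// -!natr1; lra.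
Qed.

(** * The weighted integral of polynomials *)

(* From here on, N is written m.+1.*2.+1, so that l = (N - 1) / 2 = m.+1. *)
Definition poly_weight {R : realType} (m : nat) (x : R) : R :=
  (1 - x ^+ 2) ^+ m * Num.sqrt (1 - x ^+ 2).

Lemma onem_sqr_ge0 {R : realType} (x : R) : x \in `[-1, 1] -> 0 <= 1 - x ^+ 2.
Proof. by rewrite in_itv/= => /andP[? ?]; nra. Qed.

Lemma axial_weightE {R : realType} (m : nat) (x : R) : x \in `[-1, 1] ->
  axial_weight m.+1.*2.+1 x = poly_weight m x.
Proof.
move=> /onem_sqr_ge0 x1; rewrite /axial_weight /poly_weight -powR12_sqrt//.
rewrite -(powR_mulrn m x1) -powRD.
  by congr (_ `^ _); rewrite -natr1 -mul2n natrM -natr1; field.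
(* At the endpoints the base is 0, where exponents may still be added because their sum m + 1/2 is
   not 0. *)
by apply/implyP; rewrite gt_eqF// ltr_wpDl.
Qed.

Lemma continuous_sqrt_onem_sqr {R : realType} :
  continuous (fun x : R => Num.sqrt (1 - x ^+ 2)).
Proof.
move=> x; have c : {for x, continuous (fun y : R => 1 - y ^+ 2)}.
  by apply: continuousB; [exact: cvg_cst|exact: exprn_continuous].
exact: (continuous_comp c (@sqrt_continuous _ _)).
Qed.

Lemma continuous_poly_weight {R : realType} (m : nat) :
  continuous (poly_weight m : R -> R).
Proof.
move=> x; have c : {for x, continuous (fun y : R => 1 - y ^+ 2)}.
  by apply: continuousB; [exact: cvg_cst|exact: exprn_continuous].
rewrite /continuous_at /poly_weight; apply: cvgM.
  exact: (continuous_comp c (@exprn_continuous _ m _)).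
exact: continuous_sqrt_onem_sqr.
Qed.

Lemma integrable_continuous_itv {R : realType} (f : R -> R) (a b : R) :
  continuous f -> lebesgue_measure.-integrable `[a, b] (EFin \o f).
Proof.
move=> cf; apply: continuous_compact_integrable; first exact: segment_compact.
exact: continuous_subspaceT.
Qed.

Lemma axial_intE {R : realType} (m : nat) (f : R -> R) :
  axial_int m.+1.*2.+1 f =
  \int[lebesgue_measure]_(x in `[-1, 1]) (poly_weight m x * f x).
Proof.
by apply: eq_Rintegral => x; rewrite inE => x1; rewrite axial_weightE.
Qed.

Lemma integrable_poly_weightM {R : realType} (m : nat) (f : R -> R) :
  continuous f ->
  lebesgue_measure.-integrable `[-1, 1]
    (EFin \o (fun x => poly_weight m x * f x)).
Proof.
move=> cf; apply: integrable_continuous_itv => x.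
by apply: cvgM; [exact: continuous_poly_weight|exact: cf].
Qed.

Definition poly_int {R : realType} (m : nat) (p : {poly R}) : R :=
  axial_int m.+1.*2.+1 (horner p).

Lemma poly_int_is_scalar {R : realType} (m : nat) : scalar (@poly_int R m).
Proof.
move=> a p q; rewrite /poly_int !axial_intE -RintegralZl//; last first.
  by apply: integrable_poly_weightM; exact: continuous_horner.
rewrite -RintegralD//; last 2 first.
- by apply: integrable_continuous_itv => x; apply: cvgM; first exact: cvg_cst;
    apply: cvgM; [exact: continuous_poly_weight|exact: continuous_horner].
- by apply: integrable_poly_weightM; exact: continuous_horner.
by apply: eq_Rintegral => x _; rewrite hornerD hornerZ mulrDr mulrCA.
Qed.

HB.instance Definition _ {R : realType} (m : nat) :=
  GRing.isLinear.Build R {poly R} R *%R (@poly_int R m)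
    (@poly_int_is_scalar R m).

(* The integrand is the derivative of [(1 - x^2)^(N/2) r(x)]. *)
Lemma poly_int_div {R : realType} (m : nat) (r : {poly R}) :
  poly_int m ((1 - 'X^2) * r^`() - m.+1.*2.+1%:R *: ('X * r)) = 0.
Proof.
set p := _ - _; pose s (x : R) := Num.sqrt (1 - x ^+ 2).
pose q := (1 - 'X^2) ^+ m.+1 * r.
have cs : continuous s by exact: continuous_sqrt_onem_sqr.
have cF : continuous (fun x => q.[x] * s x).
  by move=> x; apply: cvgM; [exact: continuous_horner|exact: cs].
(* The square root is not differentiable where its argument vanishes; at the endpoints the
   fundamental theorem only asks for continuity. *)
have dF (x : R) : x \in `]-1, 1[ ->
    is_derive x 1 (fun x => q.[x] * s x) (poly_weight m x * p.[x]).
  rewrite in_itv/= => /andP[x1 x2].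
  have x0 : 0 < 1 - x ^+ 2 by nra.
  have s0 : s x != 0 by rewrite gt_eqF// sqrtr_gt0.
  have ss : s x * s x = 1 - x ^+ 2 by rewrite -expr2 sqr_sqrtr// ltW.
  have ds : is_derive x 1 s (- x / s x).
    have d1 : is_derive x 1 (fun y : R => 1 - y ^+ 2) (- (2 * x)).
      by apply: is_derive_eq; rewrite /GRing.scale/=; ring.
    have := @is_derive1_comp _ Num.sqrt (fun y : R => 1 - y ^+ 2) x _ _ (is_derive1_sqrt x0) d1.
    move/is_derive_eq; apply; rewrite -/(s x); field; exact: s0.
  have := is_deriveM (is_derive_poly q x) ds; move/is_derive_eq; apply.
  transitivity (q.[x] * (- x / s x) + s x * q^`().[x]); first by [].
  rewrite /p /q /poly_weight -/(s x) derivM deriv_exp derivB derivC derivXn.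
  rewrite !(hornerM, hornerD, hornerN, hornerMn, hornerZ, horner_exp, hornerX,
    hornerC) /= exprS -ss expr1 -[m.+1.*2.+1%:R]natr1 -mul2n natrM.
  by field.
rewrite /poly_int axial_intE /Rintegral.
rewrite (@continuous_FTC2 _ _ (fun x => q.[x] * s x))//.
- by rewrite -EFinB /= /s !expr2 mulrNN !mulr1 subrr sqrtr0 !mulr0 subrr.
- apply: continuous_subspaceT => x.
  by apply: cvgM; [exact: continuous_poly_weight|exact: continuous_horner].
- split; last 2 first.
  + by apply: cvg_at_right_filter; exact: cF.
  + by apply: cvg_at_left_filter; exact: cF.
  + by move=> x /dF[].
- by move=> x /dF[_ <-]; rewrite derive1E.
Qed.

(** * Orthogonality and norms of the zonal polynomials *)

Lemma zonalE {R : realType} (m k : nat) :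
  zonal m.+1.*2.+1 k = gegenbauer (m.+1%:R : R) k.
Proof.
by rewrite /zonal; congr gegenbauer; rewrite -natr1 -mul2n natrM; field.
Qed.

(** Integration by parts, from [poly_int_div] with r = p' q. The right-hand side is symmetric in [p]
    and [q], hence so is the Laplacian. *)
Lemma poly_int_laplacian {R : realType} (m : nat) (p q : {poly R}) :
  poly_int m (axial_laplacian m.+1.*2.+1 p * q) =
  poly_int m ((1 - 'X^2) * (p^`() * q^`())).
Proof.
have := poly_int_div m (p^`() * q); rewrite derivM => /eqP.
rewrite -oppr_eq0 -linearN/= => /eqP E; apply/eqP; rewrite -subr_eq0 -linearB/=.
rewrite -E /axial_laplacian; apply/eqP; congr poly_int; rewrite -!mul_polyC.
ring.
Qed.

Lemma laplace_eigenvalue_inj {R : realType} (m : nat) :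
  injective (@laplace_eigenvalue R m.+1.*2.+1).
Proof.
move=> j k; rewrite /laplace_eigenvalue -natr1 => /eqP.
rewrite -subr_eq0 (_ : _ - _ = (j%:R - k%:R) * (j%:R + k%:R + m.+1.*2%:R));
  last by ring.
rewrite mulf_eq0 subr_eq0 eqr_nat => /orP[/eqP//|].
by rewrite -!natrD pnatr_eq0 addnS.
Qed.

(** Eigenvectors of a symmetric operator for distinct eigenvalues are orthogonal. *)
Lemma zonal_orthogonal {R : realType} (m j k : nat) : j != k ->
  poly_int m (gegenbauer m.+1%:R j * gegenbauer m.+1%:R k : {poly R}) = 0.
Proof.
move=> jk; have h i n : poly_int m ((1 - 'X^2) *
   ((gegenbauer m.+1%:R i)^`() * (gegenbauer m.+1%:R n)^`())) =
   laplace_eigenvalue m.+1.*2.+1 i *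
   poly_int m (gegenbauer m.+1%:R i * gegenbauer m.+1%:R n : {poly R}).
  rewrite -poly_int_laplacian -!zonalE axial_laplacian_zonal -scalerAl.
  by rewrite linearZ.
have := h j k; rewrite [_^`() * _]mulrC h [gegenbauer _ k * _]mulrC.
move/eqP; rewrite -subr_eq0 -mulrBl mulf_eq0 subr_eq0 => /orP[|/eqP//].
by move=> /eqP/laplace_eigenvalue_inj kj; rewrite kj eqxx in jk.
Qed.

Lemma poly_int_gegenbauerSS {R : realType} (m n : nat) (l : R) (q : {poly R}) :
  n.+2%:R * poly_int m (gegenbauer l n.+2 * q) =
  2 * (n.+1%:R + l) * poly_int m ('X * gegenbauer l n.+1 * q)
  - (n%:R + 2 * l) * poly_int m (gegenbauer l n * q).
Proof.
rewrite -!linearZ -linearB; congr poly_int.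
rewrite !scalerAl -mulrBl; congr (_ * q).
have := gegenbauerSS l n.
move: (gegenbauer l n.+2) (gegenbauer l n.+1) (gegenbauer l n) => C2 C1 C0 E.
rewrite -!mul_polyC polyC_natr E !polyCM.
by rewrite [(n.+1%:R + l)%:P]polyCD [(n%:R + _)%:P]polyCD polyCM !polyC_natr; ring.
Qed.

(** Pairing the three-term recurrence with C_(n+1) and with C_n evaluates the integral of x C_n
    C_(n+1) in two ways. This gives the ratio of consecutive norms, to be compared with
    [gegenbauer1S]. *)
Lemma zonal_norm {R : realType} (m n : nat) :
  (n%:R + m.+1%:R) * poly_int m (gegenbauer (m.+1%:R : R) n ^+ 2) =
  m.+1%:R * (gegenbauer (m.+1%:R : R) n).[1] * poly_int m 1.
Proof.
set l : R := m.+1%:R; have l0 : 0 < l by rewrite ltr0n.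
elim: n => [|n IH]; first by rewrite add0r /= expr1n hornerC mulr1.
set C := gegenbauer l in IH *.
have rec1 : n.+1%:R * poly_int m (C n.+1 ^+ 2) =
    2 * (n%:R + l) * poly_int m ('X * C n * C n.+1).
  (* The recurrence needs two earlier terms, so C_1 = 2 l x is treated directly. *)
  case: n {IH} => [|n].
    rewrite add0r mul1r /C /= expr2 -scalerAl linearZ/= mulr1.
    by rewrite -scalerAr.
  rewrite expr2 poly_int_gegenbauerSS [X in _ - _ * X]zonal_orthogonal.
    by rewrite mulr0 subr0.
  by rewrite neq_ltn ltnS leqnSn.
have rec2 : 2 * (n.+1%:R + l) * poly_int m ('X * C n * C n.+1) =
    (n%:R + 2 * l) * poly_int m (C n ^+ 2).
  apply/eqP; rewrite -subr_eq0 ['X * _ * _]mulrAC expr2 -poly_int_gegenbauerSS.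
  by rewrite zonal_orthogonal ?mulr0// neq_ltn ltnS leqnSn orbT.
apply: (@mulfI _ n.+1%:R); first by rewrite pnatr_eq0.
rewrite mulrCA rec1 [X in _ = X](_ : _ =
  l * (n.+1%:R * (C n.+1).[1]) * poly_int m 1); last by ring.
rewrite gegenbauer1S.
transitivity ((n%:R + l) *
  (2 * (n.+1%:R + l) * poly_int m ('X * C n * C n.+1))); first by ring.
by rewrite rec2 mulrCA IH; ring.
Qed.

(** * Moments of the Gaussian and the Gamma function *)

Lemma Rintegral_is_derive {R : realType} (F f : R -> R) (a b : R) : a <= b ->
  (forall x : R, is_derive x 1 F (f x)) -> continuous f ->
  \int[lebesgue_measure]_(x in `[a, b]) f x = F b - F a.
Proof.
rewrite le_eqVlt => /predU1P[<-|ab] dF cf.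
  by rewrite set_itv1 Rintegral_set1 subrr.
have cF : continuous F.
  move=> x; apply/differentiable_continuous/derivable1_diffP.
  exact: (@ex_derive _ _ _ _ _ _ _ (dF x)).
rewrite /Rintegral (@continuous_FTC2 _ _ F)//.
- exact: continuous_subspaceT.
- split; last 2 first.
  + by apply: cvg_at_right_filter; exact: cF.
  + by apply: cvg_at_left_filter; exact: cF.
  + by move=> x _; case: (dF x).
- by move=> x _; rewrite derive1E; exact: (@derive_val _ _ _ _ _ _ _ (dF x)).
Qed.

Definition gauss_moment_to {R : realType} (n : nat) (x : R) : R :=
  \int[lebesgue_measure]_(t in `[0, x]) (t ^+ n * expR (- t ^+ 2)).

(* The limit of [gauss_moment_to n] at infinity, i.e. Gamma((n + 1) / 2) / 2. *)
Fixpoint gauss_moment {R : realType} (n : nat) : R :=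
  match n with
  | 0 => Num.sqrt pi / 2
  | n1.+1 => match n1 with
    | 0 => 1 / 2
    | n2.+1 => n1%:R / 2 * gauss_moment n2
    end
  end.

Lemma is_derive_expRNsqr {R : realType} (x : R) :
  is_derive x 1 (fun t : R => expR (- t ^+ 2)) (- (2 * x) * expR (- x ^+ 2)).
Proof.
have d1 : is_derive x 1 (fun y : R => - y ^+ 2) (- (2 * x)).
  by apply: is_derive_eq; rewrite /GRing.scale/=; ring.
have := @is_derive1_comp _ expR (fun y : R => - y ^+ 2) x _ _ (is_derive_expR _) d1.
by move/is_derive_eq; apply; rewrite mulrC.
Qed.

Lemma continuous_expRNsqr {R : realType} :
  continuous (fun t : R => expR (- t ^+ 2)).
Proof.
move=> x; apply/differentiable_continuous/derivable1_diffP.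
exact: (@ex_derive _ _ _ _ _ _ _ (is_derive_expRNsqr x)).
Qed.

Lemma continuous_gauss_moment {R : realType} (n : nat) :
  continuous (fun t : R => t ^+ n * expR (- t ^+ 2)).
Proof.
by move=> x; apply: cvgM; [exact: exprn_continuous|exact: continuous_expRNsqr].
Qed.

Lemma gauss_moment_to1 {R : realType} (x : R) : 0 <= x ->
  gauss_moment_to 1 x = (1 - expR (- x ^+ 2)) / 2.
Proof.
move=> x0; rewrite /gauss_moment_to.
have D (t : R) : is_derive t 1 (fun t => (- 2^-1) * expR (- t ^+ 2))
    (t ^+ 1 * expR (- t ^+ 2)).
  have := is_deriveZ (- 2^-1) (is_derive_expRNsqr t).
  by move/is_derive_eq; apply; rewrite /GRing.scale/= expr1; field.
rewrite (Rintegral_is_derive x0 D); last exact: continuous_gauss_moment.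
by rewrite expr0n oppr0 expR0; field.
Qed.

(** Integrates the derivative of t^(n+1) exp(-t^2) / 2 over [0, x]. *)
Lemma gauss_moment_toSS {R : realType} (n : nat) (x : R) : 0 <= x ->
  gauss_moment_to n.+2 x =
  n.+1%:R / 2 * gauss_moment_to n x - x ^+ n.+1 * expR (- x ^+ 2) / 2.
Proof.
move=> x0; apply/eqP; rewrite eq_sym subr_eq addrC -subr_eq eq_sym; apply/eqP.
have ci (k : nat) := integrable_continuous_itv 0 x (@continuous_gauss_moment R k).
rewrite /gauss_moment_to -RintegralZl// -RintegralB//; last first.
  apply: integrable_continuous_itv => t.
  by apply: cvgM; [exact: cvg_cst|exact: continuous_gauss_moment].
have D (t : R) : is_derive t 1 (fun t => 2^-1 * (t ^+ n.+1 * expR (- t ^+ 2)))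
    (n.+1%:R / 2 * (t ^+ n * expR (- t ^+ 2)) - t ^+ n.+2 * expR (- t ^+ 2)).
  have dX : is_derive t 1 (fun y : R => y ^+ n.+1) (n.+1%:R * t ^+ n).
    by apply: DeriveDef; [exact: exprn_derivable|rewrite exp_derive [LHS]mulr1].
  have := is_deriveZ 2^-1 (is_deriveM dX (is_derive_expRNsqr t)).
  by move/is_derive_eq; apply; rewrite /GRing.scale/= !exprS; field.
rewrite (Rintegral_is_derive x0 D).
  by rewrite expr0n/= mul0r mulr0 subr0 mulrC.
move=> t; apply: cvgB; last exact: continuous_gauss_moment.
by apply: cvgM; [exact: cvg_cst|exact: continuous_gauss_moment].
Qed.

(** Since k^2 >= k, exp(-k^2) is at most e / exp(k + 1), and exp(k + 1) >= (k + 1)^(n+1) / (n + 1)!;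
    a constant times 1 / (k + 1) dominates. *)
Lemma cvg_exprn_expRNsqr {R : realType} (n : nat) :
  (k%:R ^+ n * expR (- k%:R ^+ 2) : R) @[k --> \oo] --> 0.
Proof.
apply: (@squeeze_cvgr _ _ _ _ (cst 0) (fun k => (n.+1)`!%:R * expR 1 * harmonic k)).
- near=> k; rewrite /= mulr_ge0 ?exprn_ge0 ?expR_ge0//=.
  have h1 : expR (- k%:R ^+ 2) <= expR 1 / expR k.+1%:R :> R.
    rewrite -expRB ler_expR -natr1 opprD addrCA subrr addr0 lerN2.
    by rewrite -natrX ler_nat; nia.
  have h2 : k.+1%:R ^+ n.+1 / n.+1`!%:R <= expR (k.+1%:R : R).
    by apply: le_trans (expR_ge1Dxn n _) => //; rewrite lerDr.
  have h3 : (k%:R : R) ^+ n <= k.+1%:R ^+ n by rewrite lerXn2r ?nnegrE// ler_nat.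
  rewrite /harmonic/=; apply: (le_trans (ler_pM _ _ h3 h1)).
  - by rewrite exprn_ge0.
  - exact: expR_ge0.
  rewrite mulrA ler_pdivrMr ?expR_gt0// mulrAC ler_pdivlMr ?ltr0n//.
  move: h2; rewrite ler_pdivrMr ?ltr0n ?fact_gt0// exprSr => h2.
  rewrite mulrAC [leRHS](_ : _ = expR k.+1%:R * n.+1`!%:R * expR 1); last by ring.
  by rewrite ler_wpM2r// expR_ge0.
- exact: cvg_cst.
- rewrite -[X in _ --> X](mulr0 (n.+1`!%:R * expR 1)).
  by apply: cvgM; [exact: cvg_cst|exact: cvg_harmonic].
Unshelve. all: by end_near. Qed.

(* Truncation at [k^2] matches truncation at [k] under [t = x^2]. *)
Lemma integral0y_cvg_sqr {R : realType} (f : R -> R) (l : R) :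
  (forall x, 0 <= f x) -> continuous f ->
  (\int[lebesgue_measure]_(x in `[0%R, k%:R ^+ 2]) f x)%R @[k --> \oo] --> l ->
  (\int[lebesgue_measure]_(x in `[0%R, +oo[) (f x)%:E = l%:E)%E.
Proof.
move=> f0 cf fl.
have mf : measurable_fun setT f by exact: continuous_measurable_fun.
have sq : (k ^ 2)%N @[k --> \oo] --> \oo.
  apply/cvgnyPge => n; near=> k; apply: (@leq_trans k); last by nia.
  by near: k; exact: nbhs_infty_ge.
have h := cvg_comp _ _ sq (@ge0_cvgn_integral R lebesgue_measure _ f0 mf).
have /cvg_lim <- // := h.
apply/cvg_lim => //; apply: cvg_EFin.
  near=> k; apply: integrable_fin_num => //.
  exact: integrable_continuous_itv.
by move: fl; apply: cvg_trans; apply: near_eq_cvg; near=> k; rewrite /= natrX.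
Unshelve. all: by end_near. Qed.

(** Induction by steps of two, starting from the Gaussian integral and the explicit first moment;
    the boundary term of [gauss_moment_toSS] tends to 0. *)
Lemma cvg_gauss_moment {R : realType} (n : nat) :
  (gauss_moment_to n k%:R : R) @[k --> \oo] --> gauss_moment n.
Proof.
elim/ltn_ind: n => -[|[|n]] IH.
- have mf : measurable_fun setT (@gauss_fun R) by exact: measurable_gauss_fun.
  have := @ge0_cvgn_integral R lebesgue_measure _ (@gauss_fun_ge0 R) mf.
  rewrite integral0y_gauss => /fine_cvg/=.
  apply: cvg_trans; apply: near_eq_cvg; near=> k => /=.
  by apply: eq_Rintegral => x _; rewrite expr0 mul1r.
- under eq_fun do rewrite gauss_moment_to1//.
  rewrite /= -[X in X / 2](subr0 1); apply: cvgMr_tmp; apply: cvgB.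
    exact: cvg_cst.
  by have := @cvg_exprn_expRNsqr R 0; under eq_fun do rewrite expr0 mul1r.
- under eq_fun do rewrite gauss_moment_toSS//.
  have -> : gauss_moment n.+2 = n.+1%:R / 2 * gauss_moment n - 0 :> R.
    by rewrite subr0.
  apply: cvgB.
    by apply: cvgMl_tmp; exact: IH.
  by rewrite -(mul0r (2^-1 : R)); apply: cvgMr_tmp;
    exact: cvg_exprn_expRNsqr.
Unshelve. all: by end_near. Qed.

Lemma Rintegral_subst_sqr {R : realType} (f : R -> R) (b : R) : 0 <= b ->
  continuous f ->
  \int[lebesgue_measure]_(x in `[0, b ^+ 2]) f x =
  \int[lebesgue_measure]_(x in `[0, b]) (f (x ^+ 2) * (2 * x)).
Proof.
move=> b0 cf; have dE : (fun x : R => x ^+ 2)^`()%classic = (fun x => 2 * x).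
  by apply/funext => x; rewrite exp_derive1 expr1.
have c2 : continuous (fun x : R => 2 * x).
  by move=> x; apply: cvgM; [exact: cvg_cst|exact: cvg_id].
rewrite /Rintegral -[X in `[X, _]](expr0n R 2).
rewrite (@integration_by_substitution_increasing _ (fun x : R => x ^+ 2))//.
- by rewrite dE.
- move=> x y; rewrite !in_itv/= => /andP[x0 _] /andP[y0 _] xy.
  by rewrite ltrXn2r.
- by rewrite dE => x _; exact: c2.
- rewrite dE; apply/cvg_ex; exists (2 * 0).
  by apply: cvg_at_right_filter; exact: c2.
- rewrite dE; apply/cvg_ex; exists (2 * b).
  by apply: cvg_at_left_filter; exact: c2.
- split.
  + by move=> x _; exact: exprn_derivable.
  + by apply: cvg_at_right_filter; exact: exprn_continuous.
  + by apply: cvg_at_left_filter; exact: exprn_continuous.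
- exact: continuous_subspaceT.
Qed.

(** Substitution t = x^2. The exponent is (n + 1) / 2, so a power of the square root extends the
    integrand continuously to the whole line. *)
Lemma Gamma_half {R : realType} (n : nat) :
  Gamma (n.+3%:R / 2 : R) = 2 * gauss_moment n.+2.
Proof.
pose f (t : R) := Num.sqrt t ^+ n.+1 * expR (- t).
have cf : continuous f.
  move=> t; apply: cvgM.
    exact: (continuous_comp (@sqrt_continuous R t) (@exprn_continuous _ n.+1 _)).
  have cN : {for t, continuous (fun x : R => - x)} by exact: opp_continuous.
  exact: (continuous_comp cN (@continuous_expR R _)).
have f0 t : 0 <= f t by rewrite mulr_ge0 ?exprn_ge0 ?expR_ge0.
have fE (t : R) : 0 < t -> t `^ (n.+3%:R / 2 - 1) * expR (- t) = f t.
  move=> t0; rewrite /f; congr (_ * _).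
  rewrite -powR12_sqrt ?ltW// -powR_mulrn ?powR_ge0// -powRrM; congr (_ `^ _).
  by rewrite -!natr1; field.
rewrite /Gamma /Rintegral.
have -> : (\int[lebesgue_measure]_(t in `]0%R, +oo[)
    (t `^ (n.+3%:R / 2 - 1) * expR (- t))%:E =
  \int[lebesgue_measure]_(t in `]0%R, +oo[) (f t)%:E)%E.
  apply: eq_integral => t; rewrite inE/= in_itv/= andbT => t0.
  by rewrite fE.
rewrite integral_itv_obnd_cbnd; last first.
  apply/measurable_EFinP; apply: measurable_funTS.
  exact: continuous_measurable_fun.
rewrite (@integral0y_cvg_sqr _ f (2 * gauss_moment n.+2))//.
have : (2 * gauss_moment_to n.+2 k%:R : R) @[k --> \oo] --> 2 * gauss_moment n.+2.
  by apply: cvgMl_tmp; exact: cvg_gauss_moment.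
apply: cvg_trans; apply: near_eq_cvg; near=> k.
rewrite Rintegral_subst_sqr// /gauss_moment_to -RintegralZl//; last first.
  by apply: integrable_continuous_itv; exact: continuous_gauss_moment.
apply: eq_Rintegral => x; rewrite inE/= in_itv/= => /andP[x0 _].
by rewrite /f sqrtr_sqr ger0_norm// [in LHS]exprSr; ring.
Unshelve. all: by end_near. Qed.

(** * The total weight *)

(** The area of a half disc, computed with x = sin t and the primitive (t + sin t cos t) / 2 of
    cos^2 t. *)
Lemma poly_int01 {R : realType} : poly_int 0 1 = pi / 2 :> R.
Proof.
rewrite /poly_int axial_intE /Rintegral.
have -> : `[(-1 : R), 1]%classic = `[sin (- (pi / 2)), sin (pi / 2)]%classic.
  by rewrite sinN sin_pihalf.
have hp : - (pi / 2) <= pi / 2 :> R by rewrite ge0_cp// divr_ge0// pi_ge0.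
have dS : (@sin R)^`()%classic = cos.
  by apply/funext => x; rewrite derive1E derive_val.
rewrite integration_by_substitution_increasing//.
- have D (t : R) : is_derive t 1 (fun t => 2^-1 * (t + sin t * cos t)) (cos t * cos t).
    apply: is_derive_eq; rewrite /GRing.scale/=.
    rewrite -[X in _ * (X + _)](cos2Dsin2 t).
    by field.
  rewrite -[LHS]/(\int[lebesgue_measure]_(x in _) _)%R.
  rewrite -[RHS](_ : 2^-1 * (pi / 2 + sin (pi / 2) * cos (pi/2)) -
    2^-1 * (- (pi / 2) + sin (- (pi / 2)) * cos (- (pi/2))) = _); last first.
    by rewrite cosN cos_pihalf !mulr0 !addr0; field.
  rewrite -(Rintegral_is_derive hp D); last first.
    by move=> t; apply: cvgM; exact: continuous_cos.
  apply: eq_Rintegral => t; rewrite inE/= in_itv/= => tp.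
  rewrite /poly_weight !fctE dS expr0 mul1r hornerC mulr1 -cos2sin2 sqrtr_sqr.
  by rewrite ger0_norm// cos_ge0_pihalf.
- by move=> x y x1 y1; rewrite ltr_sin.
- by rewrite dS => x _; exact: continuous_cos.
- rewrite dS; apply/cvg_ex; eexists.
  by apply: cvg_at_right_filter; exact: continuous_cos.
- rewrite dS; apply/cvg_ex; eexists.
  by apply: cvg_at_left_filter; exact: continuous_cos.
- split.
  + by move=> x _; exact: derivable_sin.
  + by apply: cvg_at_right_filter; exact: continuous_sin.
  + by apply: cvg_at_left_filter; exact: continuous_sin.
- apply: continuous_subspaceT => x.
  by apply: cvgM; [exact: continuous_poly_weight|exact: continuous_horner].
Qed.

(** Raising [m] multiplies the weight by 1 - x^2, and [poly_int_div] with r = x makes the integral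
    of 1 - x^2 equal to N times that of x^2. *)
Lemma poly_int1S {R : realType} (m : nat) :
  (m.*2.+4%:R * poly_int m.+1 1 : R) = m.*2.+3%:R * poly_int m 1.
Proof.
have -> : poly_int m.+1 1 = poly_int m (1 - 'X^2) :> R.
  rewrite /poly_int !axial_intE; apply: eq_Rintegral => x _.
  by rewrite /poly_weight !hornerE exprS; ring.
have := poly_int_div m ('X : {poly R}).
rewrite derivX mulr1 linearB linearZ/= => /eqP; rewrite subr_eq0 => /eqP.
have -> : poly_int m (1 - 'X^2) = poly_int m 1 - poly_int m ('X * 'X) :> R.
  by rewrite linearB.
rewrite doubleS -!natr1; move: (poly_int m 1) (poly_int m ('X * 'X)) => a b E.
by rewrite -[a](subrK b) E; ring.
Qed.

Lemma gauss_moment_gt0 {R : realType} (n : nat) : 0 < gauss_moment n :> R.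
Proof.
elim/ltn_ind: n => -[|[|n]] IH /=; rewrite ?divr_gt0 ?sqrtr_gt0 ?pi_gt0//.
by rewrite mulr_gt0 ?IH// divr_gt0// ltr0n.
Qed.

Lemma poly_int1_gt0 {R : realType} (m : nat) : 0 < poly_int m 1 :> R.
Proof.
elim: m => [|m IH]; first by rewrite poly_int01 divr_gt0// pi_gt0.
have n0 : 0 < m.*2.+4%:R :> R by rewrite ltr0n.
by rewrite -(pmulr_rgt0 _ n0) poly_int1S mulr_gt0// ltr0n.
Qed.

(** In terms of Gamma this is A Gamma((N + 1) / 2) = sqrt(pi) Gamma(N / 2); the recurrences in [m]
    of the two sides agree. *)
Lemma poly_int1_gauss_moment {R : realType} (m : nat) :
  poly_int m 1 * gauss_moment m.*2.+3 = Num.sqrt pi * gauss_moment m.*2.+2 :> R.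
Proof.
elim: m => [|m IH].
  rewrite poly_int01 /=.
  rewrite double0; set s := Num.sqrt pi.
  have -> : pi = s ^+ 2 by rewrite sqr_sqrtr// pi_ge0.
  by field.
have gS k : gauss_moment k.+2 = k.+1%:R / 2 * gauss_moment k :> R by [].
rewrite doubleS gS [in RHS]gS.
transitivity (m.*2.+4%:R * poly_int m.+1 1 / 2 * gauss_moment m.*2.+3 : R).
  ring.
by rewrite poly_int1S -[RHS]mulrCA -IH; ring.
Qed.

(** * Quadratic forms of finite zonal sums *)

Lemma zonal_norm_gt0 {R : realType} (m k : nat) :
  0 < poly_int m (gegenbauer (m.+1%:R : R) k ^+ 2).
Proof.
have p : 0 < k%:R + m.+1%:R :> R by rewrite ltr_wpDl.
rewrite -(pmulr_rgt0 _ p) zonal_norm !mulr_gt0// ?poly_int1_gt0//.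
exact: gegenbauer1_gt0.
Qed.

Definition zonal_sum {R : realType} (m : nat) (a : nat -> R) (n : nat) : {poly R} :=
  \sum_(0 <= k < n) a k *: gegenbauer m.+1%:R k.

Lemma poly_int_zonal_sum {R : realType} (m : nat) (a : nat -> R) (n k : nat) :
  poly_int m (zonal_sum m a n * gegenbauer m.+1%:R k) =
  (if (k < n)%N then a k else 0) * poly_int m (gegenbauer (m.+1%:R : R) k ^+ 2).
Proof.
rewrite /zonal_sum mulr_suml linear_sum/=.
under eq_bigr do rewrite -scalerAl linearZ/=.
case: ltnP => kn; last first.
  rewrite mul0r big_nat big1// => j /andP[_ jn].
  by rewrite zonal_orthogonal ?mulr0// ltn_eqF// (leq_trans jn).
rewrite (bigD1_seq k) ?mem_index_iota ?iota_uniq//= -expr2 big1 ?addr0// => j jk.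
by rewrite zonal_orthogonal ?mulr0.
Qed.

Lemma harmonic_proj_zonal_sum {R : realType} (m : nat) (a : nat -> R)
    (n k : nat) (x : R) :
  harmonic_proj m.+1.*2.+1 k (horner (zonal_sum m a n)) x =
  (if (k < n)%N then a k else 0) * (gegenbauer m.+1%:R k).[x].
Proof.
rewrite /harmonic_proj zonalE; congr (_ * _).
have -> : axial_int m.+1.*2.+1
    (fun y => (zonal_sum m a n).[y] * (gegenbauer m.+1%:R k).[y]) =
    poly_int m (zonal_sum m a n * gegenbauer m.+1%:R k).
  by congr axial_int; apply/funext => y; rewrite hornerM.
have -> : axial_int m.+1.*2.+1 (fun y => (gegenbauer m.+1%:R k).[y] ^+ 2) =
    poly_int m (gegenbauer (m.+1%:R : R) k ^+ 2).
  by congr axial_int; apply/funext => y; rewrite horner_exp.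
by rewrite poly_int_zonal_sum mulfK// gt_eqF// zonal_norm_gt0.
Qed.

(** Projections of degree [n] and above vanish, so the partial sums of the series are constant from
    index [n] on. *)
Lemma spectral_form_zonal_sum {R : realType} (m : nat) (F : R -> R)
    (a : nat -> R) (n : nat) :
  spectral_form m.+1.*2.+1 F (horner (zonal_sum m a n)) =
  (\sum_(0 <= k < n) F (laplace_eigenvalue m.+1.*2.+1 k) *
     (a k ^+ 2 * poly_int m (gegenbauer (m.+1%:R : R) k ^+ 2)))%:E.
Proof.
have E k : axial_int m.+1.*2.+1
    (fun x => harmonic_proj m.+1.*2.+1 k (horner (zonal_sum m a n)) x ^+ 2) =
    (if (k < n)%N then a k else 0) ^+ 2 *
      poly_int m (gegenbauer (m.+1%:R : R) k ^+ 2).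
  rewrite -[RHS]linearZ.
  congr axial_int; apply/funext => x.
  by rewrite harmonic_proj_zonal_sum hornerZ horner_exp exprMn.
rewrite /spectral_form; apply/cvg_lim => //; apply: cvg_near_cst.
near=> i; rewrite sumEFin (@big_cat_nat _ _ _ n)//=.
  rewrite [X in _ + X]big_nat [X in _ + X]big1 ?addr0.
    by congr EFin; rewrite !big_nat; apply: eq_bigr => k /andP[_ kn]; rewrite E kn.
  by move=> k /andP[nk _]; rewrite E ltnNge nk expr0n mul0r mulr0.
by near: i; exact: nbhs_infty_ge.
Unshelve. all: by end_near. Qed.

Lemma axial_sobolev_zonal_sum {R : realType} (m : nat) (s : R)
    (a : nat -> R) (n : nat) :
  axial_sobolev m.+1.*2.+1 s (horner (zonal_sum m a n)).
Proof.
split; last by rewrite spectral_form_zonal_sum ltry.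
split.
  by apply: measurable_funTS; apply: continuous_measurable_fun;
    exact: continuous_horner.
have c : continuous (fun x => (zonal_sum m a n).[x] ^+ 2).
  by move=> x; apply: cvgM; exact: continuous_horner.
apply: eq_integrable (integrable_poly_weightM m c) => //= x.
by rewrite inE => x1; rewrite axial_weightE.
Qed.

(** * Lower bounds and parity of integrals; Paneitz eigenvalues *)

Lemma le_Rintegral_itv {R : realType} (f : R -> R) (a b a' b' c : R) :
  a <= a' -> a' <= b' -> b' <= b -> continuous f ->
  (forall x, x \in `[a, b] -> 0 <= f x) ->
  (forall x, x \in `[a', b'] -> c <= f x) ->
  c * (b' - a') <= \int[lebesgue_measure]_(x in `[a, b]) f x.
Proof.
move=> aa' ab' bb' cf f0 fc.
have ci u v := integrable_continuous_itv u v cf.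
have -> : c * (b' - a') = \int[lebesgue_measure]_(x in `[a', b']) c.
  have mE : fine (lebesgue_measure (`[a', b']%classic : set R)) = b' - a'.
    rewrite lebesgue_measure_itv/= lte_fin.
    by case: ltgtP ab' => // -> _; rewrite subrr.
  by rewrite Rintegral_cst//; congr (c * _); exact/esym/mE.
apply: (@le_trans _ _ (\int[lebesgue_measure]_(x in `[a', b']) f x)).
  apply: le_Rintegral => //.
  by apply: integrable_continuous_itv => x; exact: cvg_cst.
apply: fine_le; [exact: integrable_fin_num| exact: integrable_fin_num|].
apply: ge0_subset_integral => //.
- by apply/measurable_EFinP/measurable_funTS; exact: continuous_measurable_fun.
- by move=> x /=; rewrite !in_itv/= => /andP[? ?]; apply/andP; split; lra.
Qed.

(** The reflection x -> -x changes the sign of the integral. This yields the balance condition for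
    even test functions. *)
Lemma axial_int_odd {R : realType} (m : nat) (f : R -> R) : continuous f ->
  (forall x, f (- x) = - f x) -> axial_int m.+1.*2.+1 f = 0.
Proof.
move=> cf fN; rewrite axial_intE; set g := fun x => _ * _.
have cg : continuous g.
  by move=> x; apply: cvgM; [exact: continuous_poly_weight|exact: cf].
have gN x : g (- x) = - g x by rewrite /g fN /poly_weight sqrrN mulrN.
have h1 : -1 <= 1 :> R by lra.
have := @integration_by_substitution_oppr R g (-1) 1 h1.
rewrite opprK => /(_ (continuous_subspaceT cg)).
move=> /(congr1 fine); rewrite -/(Rintegral _ _ _) => E.
have : \int[lebesgue_measure]_(x in `[-1, 1]) g x =
   -1 * \int[lebesgue_measure]_(x in `[-1, 1]) g x.
  rewrite [LHS]E -RintegralZl//; last exact: integrable_continuous_itv.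
  by apply: eq_Rintegral => x _ /=; rewrite gN mulN1r.
lra.
Qed.

(** This is C_k(1) = binom(k + 2l - 1, k), written as a product to match the eigenvalues of P_N. *)
Lemma gegenbauer1_prod {R : realType} (m k : nat) :
  m.*2.+1`!%:R * (gegenbauer (m.+1%:R : R) k).[1] =
  \prod_(0 <= j < m.*2.+1) (k.+1 + j)%:R.
Proof.
elim: k => [|k IH].
  by rewrite hornerC mulr1 -natr_prod fact_prod big_add1.
have k0 : k.+1%:R != 0 :> R by rewrite pnatr_eq0.
apply: (mulfI k0); rewrite mulrCA gegenbauer1S mulrCA IH.
transitivity (\prod_(0 <= j < m.*2.+2) (k.+1 + j)%:R : R).
  rewrite [RHS]big_nat_recr//= mulrC; congr (_ * _).
  by rewrite -natrM -natrD; congr _%:R; lia.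
rewrite [LHS]big_nat_recl//= addn0; congr (_ * _).
by apply: eq_bigr => j _; rewrite addnS addSn.
Qed.

(** In the eigenvalue k (k + 1) ... (k + N - 1) the outer factors are k and k + 2l; the inner ones
    form the product of [gegenbauer1_prod]. *)
Lemma paneitz_symbol_zonal {R : realType} (m k : nat) :
  paneitz_symbol m.+1.*2.+1 (laplace_eigenvalue m.+1.*2.+1 k) =
  k%:R * (k%:R + 2 * m.+1%:R) *
  (m.*2.+1`!%:R * (gegenbauer (m.+1%:R : R) k).[1]).
Proof.
rewrite paneitz_symbol_eigenvalue ?oddS ?odd_double// gegenbauer1_prod doubleS.
rewrite [LHS]big_nat_recl//= [X in _ * X = _]big_nat_recr//= addr0.
rewrite [RHS]mulrAC -[RHS]mulrA; congr (_ * (_ * _)).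
  by apply: eq_bigr => j _; rewrite -natrD addnS addSn.
by rewrite -natrM -!natrD; congr _%:R; lia.
Qed.

(** * The test functions *)

Definition bubble_coef {R : realType} (m k : nat) : R :=
  if odd k || (k == 0%N) then 0
  else (k%:R + m.+1%:R) / (k%:R * (k%:R + 2 * m.+1%:R)).

Definition bubble_height {R : realType} (m K : nat) : R :=
  \sum_(0 <= k < K.*2.+1) bubble_coef m k.

Definition bubbles {R : realType} (m K : nat) : {poly R} :=
  zonal_sum m (fun k => 4 * bubble_coef m k / (gegenbauer m.+1%:R k).[1])
    K.*2.+1.

Lemma bubble_coef_ge0 {R : realType} (m k : nat) : 0 <= bubble_coef m k :> R.
Proof. by rewrite /bubble_coef; case: ifP => // _; rewrite divr_ge0. Qed.

(** Absorbs one factor k of the error k (k + 1) (1 - x) from [gegenbauer_near1]. *)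
Lemma bubble_coef_le {R : realType} (m k : nat) : k%:R * bubble_coef m k <= 1 :> R.
Proof.
rewrite /bubble_coef; case: ifPn => [_|]; first by rewrite mulr0.
rewrite negb_or -lt0n => /andP[_ k0].
have k1 : 0 < k%:R :> R by rewrite ltr0n.
have d0 : 0 < k%:R + 2 * m.+1%:R :> R by rewrite addr_gt0// mulr_gt0.
rewrite [leLHS](_ : _ = (k%:R + m.+1%:R) / (k%:R + 2 * m.+1%:R)); last first.
  by field; rewrite !gt_eqF.
rewrite ler_pdivrMr// mul1r lerD2l.
by rewrite -[leLHS]mul1r ler_wpM2r// ler1n.
Qed.

Lemma bubble_heightS {R : realType} (m K : nat) :
  bubble_height m K.+1 = bubble_height m K + bubble_coef m K.+1.*2 :> R.
Proof.
rewrite /bubble_height doubleS big_nat_recr//= big_nat_recr//=.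
by rewrite {2}/bubble_coef /= odd_double/= addr0.
Qed.

(** The exponential form of S >= (log K) / 2 - O(1). *)
Lemma bubble_height_growth {R : realType} (m K : nat) :
  K%:R <= m.+2%:R * expR (2 * bubble_height m K) :> R.
Proof.
(* Adding [m.+2] on the left gives equality at K = 0, and each step then only needs the factor 1 + 1
   / (K + m + 2), supplied by exp(y) >= 1 + y. *)
suff h : (K + m.+2)%:R <= m.+2%:R * expR (2 * bubble_height m K) :> R.
  by apply: le_trans h; rewrite ler_nat leq_addr.
elim: K => [|K IH].
  by rewrite /bubble_height big_nat1 /bubble_coef/= mulr0 expR0 mulr1.
rewrite bubble_heightS mulrDr expRD mulrA.
have p : 0 < (K + m.+2)%:R :> R by rewrite ltr0n addnS.
have b : 1 + (K + m.+2)%:R^-1 <= expR (2 * bubble_coef m K.+1.*2) :> R.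
  apply: le_trans (expR_ge1Dx _); rewrite lerD2l.
  rewrite /bubble_coef /= odd_double/= -mul2n natrM.
  have -> : (K + m.+2)%:R = K.+1%:R + m.+1%:R :> R.
    by rewrite -natrD addSnnS.
  set j : R := K.+1%:R; set l : R := m.+1%:R.
  have j0 : 0 < j by rewrite ltr0n.
  have l0 : 0 < l by rewrite ltr0n.
  (* Twice the new coefficient exceeds 1 / (j + l), which is exactly the increment wanted. *)
  have -> : 2 * ((2 * j + l) / (2 * j * (2 * j + 2 * l))) =
      (j + l)^-1 + l / (2 * j * (j + l)).
    by field; rewrite !gt_eqF//; lra.
  by rewrite lerDl divr_ge0 ?ltW// mulr_gt0 ?mulr_gt0// addr_gt0.
apply: le_trans (ler_pM _ _ IH b) => //.
by rewrite mulrDr mulr1 divff ?gt_eqF// addSn natr1.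
Qed.

(** The symbol and the squared norm each carry a factor C_k(1), cancelling the squared denominator.
    The choice of b_k gives b_k^2 k (k + 2l) = b_k (k + l), and k + l cancels against the norm, so
    each degree contributes a multiple of b_k. *)
Lemma paneitz_form_bubbles {R : realType} (m K : nat) :
  paneitz_form m.+1.*2.+1 (horner (bubbles m K)) =
  8 * (m.+1.*2)`!%:R * poly_int m 1 * bubble_height m K :> R.
Proof.
rewrite /paneitz_form spectral_form_zonal_sum/= mulr_sumr.
apply: eq_bigr => k _; rewrite paneitz_symbol_zonal.
set b : R := bubble_coef m k; set l : R := m.+1%:R.
set c := (gegenbauer l k).[1]; set h := poly_int m _.
have l0 : 0 < l by rewrite ltr0n.
have c0 : c != 0 by rewrite gt_eqF// gegenbauer1_gt0.
have kl : k%:R + l != 0 by rewrite gt_eqF// ltr_wpDl.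
have hE : h = l * c * poly_int m 1 / (k%:R + l).
  by rewrite -zonal_norm mulrAC mulfV// mul1r.
have bE : b ^+ 2 * (k%:R * (k%:R + 2 * l)) = b * (k%:R + l).
  rewrite /b /bubble_coef; case: ifPn => [_|]; first by rewrite expr0n !mul0r.
  rewrite negb_or => /andP[_ k0].
  have k1 : k%:R != 0 :> R by rewrite pnatr_eq0.
  have d0 : k%:R + 2 * l != 0 by rewrite gt_eqF// ltr_wpDl// mulr_gt0.
  rewrite -/l; move: (k%:R) (l) k1 d0 => y z y0 d0.
  by field; rewrite y0 d0.
have fE : (m.+1.*2)`!%:R = 2 * l * m.*2.+1`!%:R :> R.
  by rewrite doubleS factS natrM -[m.*2.+2]doubleS -mul2n natrM.
rewrite hE fE.
transitivity (16 * l * m.*2.+1`!%:R * poly_int m 1 / (k%:R + l) *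
  (b ^+ 2 * (k%:R * (k%:R + 2 * l)))); first last.
  rewrite bE; move: (k%:R) (l) kl => y z yz.
  by field.
move: (k%:R) (l) (c) kl c0 => y z d yz d0.
by field; rewrite d0 yz.
Qed.

Lemma axial_int_bubbles {R : realType} (m K : nat) :
  axial_int m.+1.*2.+1 (horner (bubbles m K)) = 0 :> R.
Proof.
have := poly_int_zonal_sum m
  (fun k => 4 * bubble_coef m k / (gegenbauer (m.+1%:R : R) k).[1]) K.*2.+1 0.
by rewrite mulr1 /bubble_coef/= mulr0 !mul0r.
Qed.

Lemma bubblesN {R : realType} (m K : nat) (x : R) :
  (bubbles m K).[- x] = (bubbles m K).[x].
Proof.
rewrite /bubbles /zonal_sum !horner_sum; apply: eq_bigr => k _.
rewrite !hornerZ gegenbauerN /bubble_coef -signr_odd.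
by case: (odd k); rewrite /= ?mulr0 ?mul0r// expr0 mul1r.
Qed.

(** Degree k loses at most 4 (k b_k) (k + 1) (1 - x) <= 4 (2K + 1) (1 - x); over 2K + 1 degrees the
    loss is at most 8. The last hypothesis makes [gegenbauer_near1] available up to degree 2K. *)
Lemma bubbles_near1 {R : realType} (m K : nat) (x : R) :
  x <= 1 -> (K.*2.+1 ^ 2)%:R * (1 - x) <= 2 -> K.*2%:R * K.*2.+1%:R * (1 - x) <= 1 ->
  4 * bubble_height m K - 8 <= (bubbles m K).[x].
Proof.
move=> x1 h2 h1; have t0 : 0 <= 1 - x by rewrite subr_ge0.
apply: (@le_trans _ _ (\sum_(0 <= k < K.*2.+1)
   (4 * bubble_coef m k - 4 * (K.*2.+1%:R * (1 - x))))).
  rewrite big_split/= -mulr_sumr lerD2l sumrN lerN2.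
  rewrite big_const_nat iter_addr_0 subn0 -[leLHS]mulr_natl.
  move: h2; rewrite expnS expn1 natrM; nra.
rewrite /bubbles /zonal_sum horner_sum big_nat [leRHS]big_nat.
apply: ler_sum => k /andP[_ kK]; rewrite hornerZ.
have c0 : 0 < (gegenbauer (m.+1%:R : R) k).[1] by exact: gegenbauer1_gt0.
have hk : k%:R * k.+1%:R * (1 - x) <= 1.
  apply: le_trans h1; rewrite ler_wpM2r// -!natrM ler_nat.
  by rewrite leq_mul.
have l0 : 0 < m.+1%:R :> R by [].
have := gegenbauer_near1 l0 x1 hk; set d := _.[x]; set c := _.[1] in c0 *.
move=> hd; rewrite -mulrA -mulrBr -[leRHS]mulrA ler_pM2l// -mulrA.
have b0 := @bubble_coef_ge0 R m k.
apply: (@le_trans _ _ (bubble_coef m k * (1 - k%:R * k.+1%:R * (1 - x)))).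
  rewrite [leRHS]mulrBr mulr1 lerD2l lerN2 !mulrA ler_wpM2r//.
  rewrite [_ * k%:R]mulrC; apply: le_trans (_ : 1 * k.+1%:R <= _).
    by rewrite ler_wpM2r// bubble_coef_le.
  by rewrite mul1r ler_nat.
by rewrite ler_wpM2l// [leRHS]mulrC ler_pdivlMr// mulrC.
Qed.

Lemma continuous_expR_horner {R : realType} (c : R) (p : {poly R}) :
  continuous (fun x => expR (c * p.[x])).
Proof.
move=> x; have cp : {for x, continuous (fun x => c * p.[x])}.
  by apply: cvgM; [exact: cvg_cst|exact: continuous_horner].
exact: (continuous_comp cp (@continuous_expR R _)).
Qed.

(** With q = 1 / (4K), only the interval [1 - 2 q^2, 1 - q^2] is kept. Its distance to the pole
    makes 1 - x^2 >= q^2, so the weight is at least q^(N-2); the length q^2 completes the power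
    q^N. *)
Lemma axial_int_exp_bubbles {R : realType} (m K : nat) : (0 < K)%N ->
  (4 * K%:R) ^- m.+1.*2.+1 *
    expR (m.+1.*2.+1%:R * (4 * bubble_height m K - 8)) <=
  axial_int m.+1.*2.+1 (fun x : R => expR (m.+1.*2.+1%:R * (bubbles m K).[x])).
Proof.
move=> K0; set n := m.+1.*2.+1; set e := expR _; set k : R := K%:R.
have k1 : 1 <= k by rewrite ler1n.
pose q := (4 * k)^-1.
have qk : q * k = 4^-1 by rewrite /q; field; rewrite gt_eqF//; lra.
have q0 : 0 < q by rewrite invr_gt0; lra.
have q4 : q <= 4^-1 by nra.
have e0 : 0 < e by exact: expR_gt0.
rewrite axial_intE.
have -> : (4 * k) ^- n * e = q ^+ m.*2.+1 * e * (1 - q ^+ 2 - (1 - 2 * q ^+ 2)).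
  by rewrite -exprVn -/q /n doubleS !exprS; ring.
apply: le_Rintegral_itv; [nra|nra|nra| | |].
- by move=> x; apply: cvgM;
    [exact: continuous_poly_weight|exact: continuous_expR_horner].
- move=> x x1; rewrite mulr_ge0 ?expR_ge0// mulr_ge0 ?sqrtr_ge0//.
  by rewrite exprn_ge0// onem_sqr_ge0.
move=> x; rewrite in_itv/= => /andP[xl xr].
have x0 : 0 <= x by nra.
have x1 : q ^+ 2 <= 1 - x ^+ 2.
  have -> : 1 - x ^+ 2 = (1 - x) * (1 + x) by ring.
  have : q ^+ 2 <= 1 - x by lra.
  nra.
apply: ler_pM; [by rewrite exprn_ge0 ?ltW|exact: ltW| |].
  rewrite exprSr -mul2n exprM; apply: ler_pM.
  - by rewrite exprn_ge0// sqr_ge0.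
  - exact: ltW.
  - by rewrite lerXn2r// nnegrE ?sqr_ge0// (le_trans _ x1)// sqr_ge0.
  - by rewrite -[leLHS](ger0_norm (ltW q0)) -sqrtr_sqr ler_wsqrtr.
rewrite ler_expR ler_wpM2l// bubbles_near1//; first nra.
- rewrite natrX -natr1 -mul2n natrM -/k.
  nra.
- rewrite -natr1 -mul2n natrM -/k.
  nra.
Qed.

(** * Normalisation of the functional and conclusion *)

Lemma axial_int1_Gamma {R : realType} (m : nat) :
  Num.sqrt pi * Gamma (m.+1.*2.+1%:R / 2) =
  poly_int m 1 * Gamma ((m.+1.*2.+1%:R + 1) / 2) :> R.
Proof.
rewrite natr1 doubleS !Gamma_half mulrCA -poly_int1_gauss_moment; ring.
Qed.

(** By [axial_int1_Gamma] both quotients of Gamma values reduce to the total weight A, so the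
    logarithm is that of a mean value. *)
Lemma I_functionalE {R : realType} (alpha : R) (m : nat) (u : R -> R) :
  I_functional alpha m.+1.*2.+1 u =
  alpha / 2 * paneitz_form m.+1.*2.+1 u
  + (m.+1.*2)`!%:R * axial_int m.+1.*2.+1 u
  - (m.+1.*2)`!%:R * poly_int m 1 / m.+1.*2.+1%:R *
    ln (axial_int m.+1.*2.+1 (fun x => expR (m.+1.*2.+1%:R * u x)) / poly_int m 1).
Proof.
have G0 : Gamma ((m.+1.*2.+1%:R + 1) / 2) != 0 :> R.
  by rewrite natr1 doubleS Gamma_half gt_eqF// mulr_gt0// gauss_moment_gt0.
have A0 : poly_int m 1 != 0 :> R by rewrite gt_eqF// poly_int1_gt0.
have n0 : m.+1.*2.+1%:R != 0 :> R by rewrite pnatr_eq0.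
rewrite /I_functional -[_.+1.-1]/(m.+1.*2).
rewrite -[_ * Num.sqrt pi * _]mulrA axial_int1_Gamma.
congr (_ - _ * ln _).
  by rewrite mulrA -mulf_div divff// mulr1.
rewrite mulrC; congr (_ * _); move: (Gamma _) G0 => g g0.
by rewrite invfM mulrCA divff// mulr1.
Qed.

Theorem proposition1p2 (R : realType) (N : nat) (hN : (3 <= N)%N)
    (hodd : odd N) (alpha : R) (halpha : 0 < alpha)
    (hI : forall u : R -> R, L_class N u -> 0 <= I_functional alpha N u) :
  1 / 2 <= alpha.
Proof.
have [m Nm] : exists m, N = m.+1.*2.+1.
  exists (N./2.-1); rewrite prednK ?half_gt0 ?(leq_trans _ hN)//.
  by rewrite -[LHS]odd_double_half hodd.
move: hI; rewrite {hN hodd N}Nm => hI.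
rewrite leNgt; apply/negP => a2.
set A : R := poly_int m 1; have A0 : 0 < A by exact: poly_int1_gt0.
set n : R := m.+1.*2.+1%:R in hI; have n0 : 0 < n by rewrite ltr0n.
(* The three terms are the loss in [bubbles_near1], the constant in the comparison of ln(4K) with 2
   S, and the normalisation of the mean. *)
pose D := 8 + ln (4 * m.+2%:R) + ln A / n.
have bnd (K : nat) : (0 < K)%N -> (2 - 4 * alpha) * bubble_height m K <= D.
  move=> K0; set S := bubble_height m K.
  have : 0 <= I_functional alpha m.+1.*2.+1 (horner (bubbles m K)).
    apply: hI; split; first exact: axial_sobolev_zonal_sum.
    apply: axial_int_odd => [x|x]; last by rewrite bubblesN mulNr.
    by apply: cvgM; [exact: cvg_id|exact: continuous_expR_horner].
  rewrite I_functionalE paneitz_form_bubbles axial_int_bubbles mulr0 addr0.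
  have := @axial_int_exp_bubbles R m K K0; rewrite -/A -/n -/S.
  set E := axial_int _ _; set f : R := _`!%:R.
  have f0 : 0 < f by rewrite ltr0n fact_gt0.
  set k : R := 4 * K%:R; have k0 : 0 < k by rewrite mulr_gt0// ltr0n.
  move=> hE.
  have E0 : 0 < E.
    apply: lt_le_trans hE.
    by rewrite mulr_gt0 ?expR_gt0// invr_gt0 exprn_gt0.
  have lnE : n * (4 * S - 8 - ln k) <= ln E.
    rewrite -ler_expR lnK ?posrE//; apply: le_trans hE.
    rewrite mulrBr expRB mulrC ler_wpM2r ?expR_ge0//.
    by rewrite lef_pV2 ?posrE ?expR_gt0 ?exprn_gt0// expRM_natl lnK ?posrE.
  (* The cap costs 2 S out of the height 4 S; the remaining 2 S, set against the energy 4 alpha S,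
     produces the threshold 1/2. *)
  have lnk : ln k <= ln (4 * m.+2%:R) + 2 * S.
    rewrite -[X in _ + X]expRK -lnM ?posrE ?mulr_gt0 ?expR_gt0//.
    rewrite ler_ln ?posrE ?mulr_gt0 ?expR_gt0 ?ltr0n// -mulrA ler_pM2l//.
    exact: bubble_height_growth.
  rewrite subr_ge0 ln_div ?posrE// => h.
  have {}h : ln E - ln A <= n * (4 * alpha * S).
    have fA : 0 < f * A / n by rewrite divr_gt0// mulr_gt0.
    rewrite -(ler_pM2l fA); apply: le_trans h _.
    by rewrite le_eqVlt; apply/orP; left; apply/eqP; field; rewrite gt_eqF.
  have -> : D = (n * 8 + n * ln (4 * m.+2%:R) + ln A) / n.
    by rewrite /D; field; rewrite gt_eqF.
  rewrite ler_pdivlMr//.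
  have hk : n * ln k <= n * (ln (4 * m.+2%:R) + 2 * S) by rewrite ler_pM2l.
  nra.
have a0 : 0 < 2 - 4 * alpha by lra.
(* [M] is the bound on [K] that [bubble_height_growth] would impose if S <= D / (2 - 4 alpha), as
   [bnd] asserts; any larger [K] is contradictory. *)
pose M := m.+2%:R * expR (2 * (D / (2 - 4 * alpha))).
have [K KM] : exists K : nat, M < K%:R.
  by exists (Num.bound M); apply: archi_boundP; rewrite mulr_ge0 ?expR_ge0.
have K0 : (0 < K)%N.
  by rewrite -(ltr0n R); apply: le_lt_trans KM; rewrite mulr_ge0// expR_ge0.
have := bubble_height_growth m K (R := R).
rewrite leNgt => /negP; apply; apply: le_lt_trans KM.
rewrite ler_pM2l ?ltr0n// ler_expR ler_pM2l// ler_pdivlMr// mulrC.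
exact: bnd.
Qed.
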